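(* Let $X$ be a nonseparable, nowhere locally compact metric space. Then the set of bounded continuous, nowhere locally uniformly continuous real-valued functions on $X$ is not a Borel set in $C_b(X)$.
   Context: A metric space $X$ is nowhere locally compact if it is locally compact at no point, i.e., no point of $X$ has a compact neighborhood. $C_b(X)$ denotes the space of all bounded continuous real-valued functions on $X$ with the supremum norm; Borel sets in $C_b(X)$ are taken with respect to the norm topology. A function $f:X\to Y$ between metric spaces is locally uniformly continuous at a point $x\in X$ if there is a neighborhood $U$ of $x$ on which $f$ is uniformly continuous. The function $f$ is nowhere locally uniformly continuous if it is locally uniformly continuous at no point of $X$ (equivalently, $f$ is uniformly continuous on no nonempty open subset of $X$). Here $\mathbb{R}$ carries its standard metric. *)

(* Defs.v *)
From HB Require Import structures.
From mathcomp Require Import all_boot all_order all_algebra.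
From mathcomp Require Import all_classical all_reals all_analysis.

Set Implicit Arguments.
Unset Strict Implicit.
Unset Printing Implicit Defensive.

Import Order.TTheory GRing.Theory Num.Theory.
Import numFieldNormedType.Exports.

Local Open Scope classical_set_scope.
Local Open Scope ring_scope.

Definition separable (T : topologicalType) : Prop :=
  exists2 D : set T, countable D & dense D.

Definition locally_compact_at (T : topologicalType) (x : T) : Prop :=
  exists2 K : set T, nbhs x K & compact K.

Definition nowhere_locally_compact (T : topologicalType) : Prop :=
  forall x : T, ~ locally_compact_at x.

(* [U] is coerced to the subtype of its elements, which carries the uniform
   structure induced by that of [X]. *)
Definition unif_continuous_on (X Y : uniformType) (U : set X) (f : X -> Y) :
    Prop :=
  unif_continuous (f \o (set_val : U -> X)).

Definition locally_unif_continuous_at (X Y : uniformType) (f : X -> Y) (x : X) :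
    Prop :=
  exists2 U : set X, nbhs x U & unif_continuous_on U f.

Definition nowhere_locally_unif_continuous (X Y : uniformType) (f : X -> Y) :
    Prop :=
  forall x : X, ~ locally_unif_continuous_at f x.

Definition borel (T : topologicalType) : set (set T) := <<s @open T >>.

Section bounded_continuous.
Variables (R : realType) (X : metricType R).

Definition bcont : {pred X -> R} :=
  mem [set f : X -> R | continuous f /\ bounded_fun f].

Record Cb := MkCb { Cb_fun :> X -> R ; _ : Cb_fun \in bcont }.

HB.instance Definition _ := [isSub for Cb_fun].
HB.instance Definition _ := [Choice of Cb by <:].

Lemma Cb_continuous (f : Cb) : continuous f.
Proof. by have /set_mem[] := valP f. Qed.

Lemma Cb_bounded (f : Cb) : bounded_fun f.
Proof. by have /set_mem[] := valP f. Qed.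

Lemma bounded_fun_leP (f : X -> R) :
  bounded_fun f <-> exists M, forall x, `|f x| <= M.
Proof.
split=> [/pinfty_ex_gt0[M _ fM]|[M fM]]; first by exists M => x; exact: fM.
exists M; split=> [|N MN x _ /=]; first exact: num_real.
exact: le_trans (fM x) (ltW MN).
Qed.

Lemma bcont_submod_closed : submod_closed bcont.
Proof.
split.
  apply: mem_set; split; first by move=> x; exact: cvg_cst.
  by apply/bounded_fun_leP; exists 0 => x; rewrite normr0.
move=> a f g /set_mem[cf /bounded_fun_leP[M fM]].
move=> /set_mem[cg /bounded_fun_leP[N gN]]; apply: mem_set; split.
  by move=> x; apply: cvgD; [apply: cvgZl_tmp; exact: cf|exact: cg].
apply/bounded_fun_leP; exists (`|a| * M + N) => x.
by rewrite (le_trans (ler_normD _ _))// lerD// normrM ler_wpM2l.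
Qed.

HB.instance Definition _ :=
  GRing.isSubmodClosed.Build _ _ bcont bcont_submod_closed.
HB.instance Definition _ := [SubChoice_isSubLmodule of Cb by <:].

(* On an empty [X] this is [sup set0 = 0], the right norm for the zero space. *)
Definition sup_norm (f : Cb) : R := sup (range (fun x => `|f x|)).

Lemma sup_norm_ub (f : Cb) x : `|f x| <= sup_norm f.
Proof.
have /bounded_fun_leP[M fM] := @Cb_bounded f.
by apply: ub_le_sup; [exists M => _ [y _ <-]|exists x].
Qed.

Lemma sup_norm_le (f : Cb) (M : R) :
  0 <= M -> (forall x, `|f x| <= M) -> sup_norm f <= M.
Proof.
move=> M0 fM; rewrite /sup_norm.
have [->|/set0P fn0] := eqVneq (range (fun x => `|f x|)) set0.
  by rewrite sup0.
by apply: ge_sup => // _ [x _ <-].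
Qed.

Lemma sup_norm_ge0 (f : Cb) : 0 <= sup_norm f.
Proof.
rewrite /sup_norm.
have [->|/set0P[_ [x _ _]]] := eqVneq (range (fun x => `|f x|)) set0.
  by rewrite sup0.
exact: le_trans (sup_norm_ub f x).
Qed.

Lemma ler_sup_normD (f g : Cb) : sup_norm (f + g) <= sup_norm f + sup_norm g.
Proof.
apply: sup_norm_le => [|x]; first by rewrite addr_ge0 ?sup_norm_ge0.
by rewrite (le_trans (ler_normD _ _))// lerD ?sup_norm_ub.
Qed.

Lemma sup_normZ (a : R) (f : Cb) : sup_norm (a *: f) = `|a| * sup_norm f.
Proof.
have le_normZ (b : R) (g : Cb) : sup_norm (b *: g) <= `|b| * sup_norm g.
  apply: sup_norm_le => [|x]; first by rewrite mulr_ge0 ?sup_norm_ge0.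
  by rewrite normrM ler_wpM2l ?sup_norm_ub.
apply/le_anti; rewrite le_normZ/=.
have [->|a0] := eqVneq a 0; first by rewrite normr0 mul0r sup_norm_ge0.
rewrite -ler_pdivlMl ?normr_gt0// -normfV.
by rewrite -{1}[f](scalerK a0) le_normZ.
Qed.

Lemma sup_norm0_eq0 (f : Cb) : sup_norm f = 0 -> f = 0.
Proof.
move=> f0; apply/val_inj/funext => x; apply/eqP.
by rewrite -normr_le0 -f0; exact: sup_norm_ub.
Qed.

HB.instance Definition _ :=
  Lmodule_isNormed.Build R Cb ler_sup_normD sup_normZ sup_norm0_eq0.

End bounded_continuous.

(* Main.v *)
Require Import Defs.
From HB Require Import structures.
From mathcomp Require Import all_boot all_order all_algebra.
From mathcomp Require Import all_classical all_reals all_analysis.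
From mathcomp Require Import ring lra.
Import Order.TTheory GRing.Theory Num.Theory.
Import numFieldNormedType.Exports.
Local Open Scope classical_set_scope.
Local Open Scope ring_scope.

Set Implicit Arguments.
Unset Strict Implicit.
Unset Printing Implicit Defensive.

(** Since [X] is not separable, it contains an [s]-separated family
    [(c_i)_(i in T)] indexed by a well-ordered set [T] of type omega_1.  Let
    [w_i] in the Cantor space code the initial segment of [T] below [i]; the
    set [{w_i}] is not analytic, by boundedness of analytic sets of
    well-orders.  Starting from one bounded continuous nowhere locally uniformly
    continuous [h], multiply [h] near [c_i] by the distance from [x] to [w_i].
    The resulting function depends continuously on the point [x] of the
    Cantor space and is nowhere locally uniformly continuous iff [x] is none of
    the [w_i].  If the set of such functions were Borel, then [{w_i}] would
    be Borel, hence analytic.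

    The function [h] is the limit of [f_(n+1) = f_n + u_n] with
    [0 <= u_n <= 8^-n], where [u_n] is supported on small balls around the
    points of a maximal [1/(n+1)]-separated set; in each of these balls one can
    choose whether to add a rapidly oscillating bump so that [f_(n+1)] oscillates by
    [8^-n / 2] at arbitrarily small scales, and the later terms are too small to
    destroy this. *)

(** * Analytic subsets of the Cantor space *)

Definition agree {T : Type} (n : nat) (x y : nat -> T) : Prop :=
  forall k, (k < n)%N -> x k = y k.

Lemma agree_sym {T : Type} n (x y : nat -> T) : agree n x y -> agree n y x.
Proof. by move=> xy k kn; rewrite xy. Qed.

Lemma agree_trans {T : Type} n (y x z : nat -> T) :
  agree n x y -> agree n y z -> agree n x z.
Proof. by move=> xy yz k kn; rewrite xy// yz. Qed.

Lemma agreeW {T : Type} {m n} {x y : nat -> T} :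
  (m <= n)%N -> agree n x y -> agree m x y.
Proof. by move=> mn xy k km; apply: xy; exact: leq_trans mn. Qed.

(* [Q] is closed in the product of the Cantor and the Baire space. *)
Definition closed_rel (Q : (nat -> bool) -> (nat -> nat) -> Prop) : Prop :=
  forall x y,
    (forall n, exists x' y', [/\ agree n x x', agree n y y' & Q x' y']) ->
    Q x y.

Definition analytic (A : set (nat -> bool)) : Prop :=
  exists2 Q, closed_rel Q & forall x, A x <-> exists y, Q x y.

(** Digit 0 of a witness names the set of the union; the remaining digits are a witness for that
    set. *)
Lemma analytic_bigcup (A : nat -> set (nat -> bool)) :
  (forall n, analytic (A n)) -> analytic (\bigcup_n A n).
Proof.
move=> /(_ _)/cid2-/all_sig2[Q cQ AQ].
exists (fun x y => Q (y 0%N) x (y \o succn)).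
  move=> x y h; apply: cQ => n; have [x' [y' [xx' yy' Qx']]] := h n.+1.
  exists x', (y' \o succn); split.
  - exact: agreeW xx'.
  - by move=> k kn; apply: yy'.
  - by rewrite (yy' 0%N).
move=> x; split=> [[n _ /AQ[y Qy]]|[y Qy]].
  by exists (fun k => if k is k'.+1 then y k' else n).
by exists (y 0%N) => //; apply/AQ; exists (y \o succn).
Qed.

(** One sequence carries witnesses for all the sets at once, as columns under the pairing
    [pickle]. *)
Lemma analytic_bigcap (A : nat -> set (nat -> bool)) :
  (forall n, analytic (A n)) -> analytic (\bigcap_n A n).
Proof.
move=> /(_ _)/cid2-/all_sig2[Q cQ AQ].
exists (fun x y => forall n, Q n x (fun k => y (pickle (n, k)))).
  move=> x y h n; apply: cQ => m.
  (* The first [M] digits of a sequence contain the first [m] digits of its column [n]. *)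
  pose M := (m + \max_(k < m) (pickle (n, k : nat)).+1)%N.
  have [x' [y' [xx' yy' Qx']]] := h M.
  exists x', (fun k => y' (pickle (n, k))); split=> //.
    exact: agreeW (leq_addr _ _) xx'.
  move=> k km; apply: yy'; apply: leq_trans (leq_addl _ _).
  exact: (leq_bigmax (Ordinal km)).
move=> x; split=> [Ax|[y Qy] n _]; last first.
  by apply/AQ; exists (fun k => y (pickle (n, k))).
have /choice[y Qy] n := (AQ n x).1 (Ax n I).
exists (fun j => if unpickle j is Some (n, k) then y n k else 0%N) => n.
by under eq_fun do rewrite pickleK.
Qed.

(** Symmetric under complement by design, so closure under countable unions already yields a
    sigma-algebra. *)
Definition bianalytic (A : set (nat -> bool)) : Prop :=
  analytic A /\ analytic (~` A).

(** A witness for [U] is a length of agreement that forces membership; the complement is closed, and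
    any sequence serves as witness. *)
Lemma bianalytic_open (U : set (nat -> bool)) :
  (forall x, U x -> exists n, forall x', agree n x x' -> U x') -> bianalytic U.
Proof.
move=> oU; split.
  exists (fun x y => forall x', agree (y 0%N) x x' -> U x').
    move=> x y h x' xx'; have [x1 [y1 [xx1 yy1 U1]]] := h (y 0%N).+1.
    apply: U1; rewrite -(yy1 0%N)//.
    apply: agree_trans xx'; apply: agree_sym; exact: agreeW xx1.
  move=> x; split=> [/oU[n xU]|[y]]; first by exists (fun=> n).
  by apply.
exists (fun x _ => ~ U x); last first.
  by move=> x; split=> [|[]//]; exists (fun=> 0%N).
move=> x y h /oU[n xU]; have [x' [_ [xx' _]]] := h n.
by apply; exact: xU.
Qed.

Lemma bianalytic_setC A : bianalytic A -> bianalytic (~` A).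
Proof. by move=> [aA aCA]; split=> //; rewrite setCK. Qed.

Lemma bianalytic_bigcup (A : nat -> set (nat -> bool)) :
  (forall n, bianalytic (A n)) -> bianalytic (\bigcup_n A n).
Proof.
move=> aA; split; first by apply: analytic_bigcup => n; have [] := aA n.
by rewrite setC_bigcup; apply: analytic_bigcap => n; have [] := aA n.
Qed.

Lemma borel_preimage_bianalytic (T : topologicalType)
    (F : (nat -> bool) -> T) (B : set T) :
  (forall U, open U -> forall x, U (F x) ->
    exists n, forall x', agree n x x' -> U (F x')) ->
  borel B -> bianalytic (F @^-1` B).
Proof.
move=> cF; suff : @borel T `<=` [set B | bianalytic (F @^-1` B)] by exact.
apply: smallest_sub; last first.
  by move=> U oU; apply: bianalytic_open => x; exact: cF.
split=> /=.
- by apply: bianalytic_open => x /=.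
- by move=> A; rewrite setTD; exact: bianalytic_setC.
- by move=> A; rewrite preimage_bigcup; exact: bianalytic_bigcup.
Qed.

(** * Codes of the initial segments of omega_1 *)

Record omega1_like (T : Type) (lt : T -> T -> Prop) : Prop := Omega1Like {
  o1_trans : forall b a c, lt a b -> lt b c -> lt a c;
  o1_total : forall a b, [\/ lt a b, a = b | lt b a];
  o1_wf : forall A : set T, A !=set0 ->
    exists2 a, A a & forall b, A b -> ~ lt b a;
  o1_countable : forall a, countable [set b | lt b a];
  o1_uncountable : ~ countable [set: T] }.

Section codes.
Variables (T : Type) (lt : T -> T -> Prop).
Hypothesis oT : omega1_like lt.
Variable e : T -> T -> nat.
Hypothesis e_inj :
  forall i c d, lt c i -> lt d i -> e i c = e i d -> c = d.

(* The order of the initial segment below [i], transported to [nat] by [e i]. *)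
Definition order_code (i : T) (n : nat) : bool :=
  `[< exists c d, [/\ lt c d, lt d i & n = pickle (e i c, e i d)] >].

(** Otherwise [T] would be the countable union of the points [b k] and the countable segments below
    them. *)
Lemma o1_bounded (b : nat -> T) : exists t, forall k, lt (b k) t.
Proof.
apply: contrapT => h; apply: (o1_uncountable oT).
pose B (kj : nat * bool) :=
  if kj.2 then [set c | lt c (b kj.1)] else [set b kj.1].
suff /subset_card_le/sub_countable : [set: T] `<=` \bigcup_kj B kj.
  apply; apply: bigcup_countable => // -[k []] _; last exact: countable1.
  exact: o1_countable oT _.
move=> t _; apply: contrapT => ht; apply: h; exists t => k.
have [//|bt|tb] := o1_total oT (b k) t; exfalso; apply: ht.
  by exists (k, false).
by exists (k, true).
Qed.

(* [P i c] is meant for [c < i]; [P] is big when the rank of [c] below [i] is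
   unbounded in omega_1. *)
Let big (P : T -> T -> Prop) :=
  forall b, exists i c, [/\ P i c, lt b c & lt c i].

(** If the part with value [k] were bounded by [b k] for every [k], a common bound of all the [b k]
    would contradict the bigness of [P]. *)
Let big_pigeonhole (f : T -> T -> nat) P :
  big P -> exists k, big (fun i c => P i c /\ f i c = k).
Proof.
move=> bP; apply: contrapT => /forallNP h.
have /choice[b hb] k : exists b, forall i c, P i c -> f i c = k -> lt b c ->
    ~ lt c i.
  have /existsNP[b /forallNP hb] := h k.
  exists b => i c Pic fk bc ci; apply: (hb i); by exists c.
have [t bt] := o1_bounded b; have [i [c [Pic tc ci]]] := bP t.
by apply: (hb _ _ _ Pic erefl) ci; apply: o1_trans tc.
Qed.

(** Pairs with room for a larger [d] in [P] still form a big family: past [b] take [b'], then [d]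
    past [b'], and let [b'] be the new element. The three values are then fixed by one
    pigeonhole. *)
Let big_step (w : T -> nat -> bool) (y : T -> nat -> nat) n P : big P ->
  exists P' a bx u, big P' /\ forall i c, P' i c ->
    [/\ lt c i, e i c = a, w i n = bx, y i n = u &
        exists2 d, P i d & lt c d].
Proof.
move=> bP; pose P0 i c := exists d, [/\ P i d, lt c d & lt d i].
have /(big_pigeonhole (fun i c => pickle (e i c, w i n, y i n)))[k bk] : big P0.
  move=> b; have [b' /(_ 0%N) bb'] := o1_bounded (fun=> b).
  have [i [c [Pic b'c ci]]] := bP b'; exists i, b'; split=> //.
    by exists c.
  exact: o1_trans b'c ci.
exists (fun i c => P0 i c /\ pickle (e i c, w i n, y i n) = k).
pose abu := odflt (0%N, false, 0%N) (unpickle k).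
exists abu.1.1, abu.1.2, abu.2; split=> // i c [[d [Pid cd di]] ek].
rewrite /abu -ek pickleK/=; split=> //; [exact: o1_trans di|by exists d].
Qed.

(* Given witnesses [y i] that the codes lie in an analytic set, keep refining a
   big family: the pigeonhole fixes one more digit of the code and of the
   witness, while bigness leaves room for one more step of a descending
   sequence.  The limit [x] of the codes is then ill-founded. *)
Lemma order_code_descending (y : T -> nat -> nat) :
  exists a x u, forall n, exists i h,
    [/\ agree n x (order_code i), agree n u (y i),
        forall k, (k < n)%N -> e i (h k) = a k /\ lt (h k) i &
        forall k, (k.+1 < n)%N -> lt (h k.+1) (h k)].
Proof.
have /choice[F F_step] (nP : nat * {P | big P}) :
    exists Pabu : {P | big P} * (nat * bool * nat),
    forall i c, sval Pabu.1 i c ->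
      [/\ lt c i, e i c = Pabu.2.1.1, order_code i nP.1 = Pabu.2.1.2,
          y i nP.1 = Pabu.2.2 & exists2 d, sval nP.2 i d & lt c d].
  have [P' [a [b [u [bP' P'E]]]]] :=
    big_step order_code y nP.1 (svalP nP.2).
  by exists (exist _ _ bP', (a, b, u)).
have big0 : big (fun=> xpredT).
  move=> b; have [c /(_ 0%N) bc] := o1_bounded (fun=> b).
  by have [i /(_ 0%N) ci] := o1_bounded (fun=> c); exists i, c.
pose S := fix S n := if n is m.+1 then (F (m, S m)).1 else exist _ _ big0.
pose v n := (F (n, S n)).2.
exists (fun n => (v n).1.1), (fun n => (v n).1.2), (fun n => (v n).2) => n.
(* Unwinding the refinements, [c] is the last term of a descending chain of length [n] below [i]
   with the prescribed digits; the earlier terms are the larger elements [d] of [big_step]. *)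
have SP i c : sval (S n) i c -> exists h,
    [/\ forall k, (k < n)%N ->
          [/\ lt (h k) i, e i (h k) = (v k).1.1,
           order_code i k = (v k).1.2 & y i k = (v k).2],
        forall k, (k.+1 < n)%N -> lt (h k.+1) (h k) &
        (0 < n)%N -> h n.-1 = c].
  elim: n c => [|n IH] c; first by exists (fun=> c).
  move=> /(F_step (n, S n))[ci eic wi yi [d /IH[h [h1 h2 h3]] cd]].
  exists (fun k => if (k < n)%N then h k else c); split=> [k|k|_].
  - rewrite ltnS leq_eqVlt => /predU1P[->|kn]; last by rewrite kn; exact: h1.
    by rewrite ltnn.
  - rewrite ltnS => kn; rewrite kn.
    move: kn; rewrite leq_eqVlt => /predU1P[kn|kn]; last first.
      by rewrite kn; exact: h2.
    by rewrite kn ltnn; move: h3; rewrite -kn => /(_ isT)/= ->.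
  - by rewrite ltnn.
have big_inh P : big P -> exists i c, P i c.
  move=> bP; suff [b _] : [set: T] !=set0.
    by have [i [c [Pic _ _]]] := bP b; exists i, c.
  apply/set0P/eqP => T0; apply: (o1_uncountable oT); rewrite T0.
  exact: countable0.
have [i [c /SP[h [h1 h2 _]]]] := big_inh _ (svalP (S n)).
exists i, h; split=> // k kn; by have [] := h1 k kn.
Qed.

(** Closedness of [Q] puts the limit [x] among the codes, say of [j]. The numbers [a k] then name an
    infinite descending sequence below [j], against well-foundedness. *)
Lemma order_codes_nonanalytic : ~ analytic (range order_code).
Proof.
move=> [Q cQ QP].
have /choice[y Qy] i : exists y, Q (order_code i) y by apply/QP; exists i.
have [a [x [u axu]]] := order_code_descending y.
have [j _ jx] : range order_code x.
  apply/QP; exists u; apply: cQ => n; have [i [h [xi ui _ _]]] := axu n.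
  by exists (order_code i), (y i).
have jP k : exists c d, [/\ lt c d, lt d j, a k.+1 = e j c & a k = e j d].
  pose n := pickle (a k.+1, a k).
  (* Long enough for the agreement to reach digit [n] and for the chain to contain [h k.+1]. *)
  have [i [h [xi _ ah dh]]] := axu (n + k.+2)%N.
  have : order_code j n.
    rewrite jx xi; last by rewrite -[ltnLHS]addn0 ltn_add2l.
    have [[e1 l1] [e0 l0]] := (ah k.+1 (leq_addl _ _),
      ah k (leq_trans (leqnSn _) (leq_addl _ _))).
    apply/asboolP; exists (h k.+1), (h k); split=> //; last by rewrite e1 e0.
    by apply: dh; exact: leq_addl.
  move=> /asboolP[c [d [cd dj /(pcan_inj pickleK)[ac ad]]]].
  by exists c, d.
have /choice[d dP] k : exists d, lt d j /\ e j d = a k.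
  by have [_ [d [_ ? _ ?]]] := jP k; exists d.
have d_desc k : lt (d k.+1) (d k).
  have [c [c' [cc' c'j ac ac']]] := jP k.
  have [[l1 e1] [l0 e0]] := (dP k.+1, dP k).
  rewrite (e_inj l1 (o1_trans oT cc' c'j)) ?e1//.
  by rewrite (e_inj l0 c'j) ?e0.
have [_ [k _ <-] mink] := o1_wf oT (A := range d) (ex_intro _ _ (imageT d 0%N)).
by apply: (mink (d k.+1)) => //; exists k.+1.
Qed.

End codes.

(** * A well-order of type omega_1 inside an uncountable set *)

Lemma countable_preimage_inj {T U : Type} (f : T -> U) (A : set T) (B : set U) :
  injective f -> f @` A `<=` B -> countable B -> countable A.
Proof.
move=> finj AB /countable_injP[g ginj]; apply/countable_injP.
exists (g \o f) => a b /set_mem Aa /set_mem Ab /ginj.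
by rewrite !inE => h; apply/finj/h; apply: AB; [exists a|exists b].
Qed.

Lemma countable_set_type {T : Type} (A : set T) :
  countable [set: A] -> countable A.
Proof.
move=> cA; apply: (sub_countable _ cA).
apply: card_le_trans (card_image_le (set_val : A -> T) _).
by apply: subset_card_le => a Aa; exists (SigSub (mem_set Aa)).
Qed.

Lemma uncountable_omega1_like (S : choiceType) (D : set S) : ~ countable D ->
  exists (T : Type) (lt : T -> T -> Prop) (f : T -> S),
    [/\ omega1_like lt, injective f & range f `<=` D].
Proof.
move=> ncD; have [R woR] := wochoice.well_ordering_principle D.
have Rmin (A : set D) : A !=set0 -> exists2 a, A a & forall b, A b -> R a b.
  move=> [x Ax].
  have [|a [[aA lea] _]] := woR [in A]; first by exists x; apply: mem_set.
  by exists a => [|b Ab]; [apply: set_mem|apply: lea; apply: mem_set].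
(* The order axioms are recovered from unique least elements: antisymmetry and totality from those
   of pairs, transitivity from those of triples. *)
have Ranti a b : R a b -> R b a -> a = b.
  move=> ab ba; have [|z [_ zE]] := woR [in [set a; b]].
    by exists a; apply: mem_set; left.
  have Rxx x : R x x.
    by have [_ -> xx] := Rmin [set x] (ex_intro _ x erefl); exact: xx.
  by rewrite -(zE a) ?(zE b)//; split=> [|x /set_mem[->|->]//];
    apply: mem_set; [right|left].
have Rtot a b : R a b \/ R b a.
  have [|c [->|->] h] := Rmin [set a; b]; first by exists a; left.
    by left; apply: h; right.
  by right; apply: h; left.
pose lt a b := ~ R b a.
have ltP a b : [\/ lt a b, a = b | lt b a].
  have [ba|] := pselect (R b a); last by constructor 1.
  have [ab|] := pselect (R a b); last by constructor 3.
  by constructor 2; exact: Ranti.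
have lt_trans b a c : lt a b -> lt b c -> lt a c.
  move=> ab bc ca.
  have [|m [[->|->]|->] h] := Rmin ([set a; b] `|` [set c]).
  - by exists a; left; left.
  - have ac : a = c by apply: Ranti => //; apply: h; right.
    by have [ac'|] := Rtot a b; [apply: bc; rewrite -ac|].
  - by apply: ab; apply: h; left; left.
  - by apply: bc; apply: h; left; right.
have lt_wf (A : set D) : A !=set0 -> exists2 a, A a & forall b, A b -> ~ lt b a.
  by move=> /Rmin[a Aa h]; exists a => // b /h Rab; apply.
pose bad := [set a | ~ countable [set b | lt b a]].
(* The least uncountable initial segment, if there is one, has type omega_1. *)
have [I [ncI cI]] : exists I : set D,
    ~ countable I /\ forall a, I a -> countable [set b | lt b a].
  have [/lt_wf[a bada h]|bad0] := pselect (bad !=set0).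
    exists [set b | lt b a]; split=> // b ba.
    by apply: contrapT => badb; exact: (h b).
  exists setT; split=> [/countable_set_type//|a _].
  by apply: contrapT => bada; apply: bad0; exists a.
exists I, (fun a b => lt (val a) (val b)), (fun a => val (val a)); split.
- split.
  + by move=> b a c; exact: lt_trans.
  + move=> a b; have [] := ltP (val a) (val b); first by constructor 1.
      by move=> /val_inj; constructor 2.
    by constructor 3.
  + move=> A [a Aa]; have [|_ [b Ab <-] h] := lt_wf (val @` A).
      by exists (val a), a.
    by exists b => // c Ac; apply: h; exists c.
  + move=> a; apply: countable_preimage_inj val_inj _ (cI (val a) (set_valP a)).
    by move=> _ [b + <-].
  + by move=> /countable_set_type.
- by move=> a b /val_inj/val_inj.
- by move=> _ [a _ <-]; exact: set_valP.
Qed.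

(** * Oscillation in metric spaces *)

Section metric_space.
Context {R : realType} {X : metricType R}.
Implicit Types (f g h : X -> R) (U : set X) (q p : X).

Lemma nbhs_mdistP q U :
  nbhs q U <-> exists2 r : R, 0 < r & forall a, mdist q a < r -> U a.
Proof.
rewrite -nbhs_ballE; split=> -[r r0 qU]; exists r => // a; last first.
  by rewrite ballEmdist; exact: qU.
by move=> qa; apply: qU; rewrite ballEmdist.
Qed.

Lemma continuous_mdistP f : continuous f <->
  forall q (eps : R), 0 < eps ->
    exists2 r : R, 0 < r & forall a, mdist q a < r -> `|f q - f a| < eps.
Proof.
split=> [cf q eps eps0|cf q].
  by have /cvgrPdist_lt/(_ _ eps0)/nbhs_mdistP := cf q.
by apply/cvgrPdist_lt => eps eps0; apply/nbhs_mdistP; exact: cf.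
Qed.

Lemma unif_continuous_onP U f : unif_continuous_on U f <->
  forall eps : R, 0 < eps -> exists2 r : R, 0 < r &
    forall a b, U a -> U b -> mdist a b < r -> `|f a - f b| < eps.
Proof.
split=> [ucf eps eps0|ucf V].
  have := ucf [set xy : R * R | ball xy.1 eps xy.2].
  move=> /(_ (entourage_ball _ (PosNum eps0))).
  move=> [W entW WE].
  move: entW; rewrite -entourage_ballE => -[r r0 rW].
  exists r => // a b Ua Ub ab.
  apply: (WE (SigSub (mem_set Ua), SigSub (mem_set Ub))).
  by apply: rW; rewrite /= ballEmdist.
move=> entV; have : entourage V by [].
rewrite -entourage_ballE => -[eps eps0 epsV].
have [r r0 rf] := ucf _ eps0.
exists [set xy : X * X | ball xy.1 r xy.2].
  exact: (entourage_ball _ (PosNum r0)).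
move=> [a b]/=; rewrite ballEmdist => ab; apply: epsV.
by apply: rf ab; exact: set_valP.
Qed.

(** For some [c > 0] this is the failure of uniform continuity on [U]; an explicit [c] can be
    weighed against later perturbations. *)
Definition osc_ge (c : R) f U : Prop := forall r : R, 0 < r ->
  exists a b, [/\ U a, U b, mdist a b < r & c <= `|f a - f b|].

Lemma nowhere_locally_unif_continuousP f :
  nowhere_locally_unif_continuous f <->
  forall q (r : R), 0 < r ->
    exists2 c : R, 0 < c & osc_ge c f [set a | mdist q a < r].
Proof.
split=> [nf q r r0|nf q [U /nbhs_mdistP[r r0 rU] /unif_continuous_onP ucf]].
  apply: contrapT => hf; apply: (nf q).
  exists [set a | mdist q a < r]; first by apply/nbhs_mdistP; exists r.
  apply/unif_continuous_onP => eps eps0; apply: contrapT => he; apply: hf.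
  exists eps => // s s0; apply: contrapT => hs; apply: he.
  exists s => // a b qa qb ab.
  by rewrite ltNge; apply/negP => h; apply: hs; exists a, b.
have [c c0 /=] := nf q r r0; have [s s0 sf] := ucf c c0.
move=> /(_ s s0)[a [b [/rU Ua /rU Ub ab]]].
by rewrite leNgt sf.
Qed.

(** If [f] varies by less than [c / 2] below some scale [s], then below [s] it cannot cancel more
    than half of the oscillation of [g]. *)
Lemma osc_geD c f g U : osc_ge c g U ->
  osc_ge (c / 2) f U \/ osc_ge (c / 2) (fun a => f a + g a) U.
Proof.
move=> gU; apply/or_asboolP; rewrite -implyNb; apply/implyP => /asboolPn nf.
apply/asboolP => r r0; move: nf => /existsNP[s /not_implyP[s0 hs]].
have [|a [b [Ua Ub ab cab]]] := gU (Num.min r s); first by rewrite lt_min r0.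
move: ab; rewrite lt_min => /andP[ar bs]; exists a, b; split=> //.
have : `|f a - f b| < c / 2.
  by rewrite ltNge; apply/negP => h; apply: hs; exists a, b.
rewrite opprD addrACA => fab.
have := ler_normB (f a - f b + (g a - g b)) (f a - f b).
by rewrite [X in `|X - _|]addrC addrK; lra.
Qed.

Definition no_cluster (z : nat -> X) : Prop := forall q,
  exists2 r : R, 0 < r & exists N, forall n, (N <= n)%N -> r <= mdist q (z n).

Lemma no_cluster_isolated z : no_cluster z -> forall q,
  exists2 r : R, 0 < r & forall n, mdist q (z n) < r -> z n = q.
Proof.
move=> zP q; have [r r0 [N zN]] := zP q.
have [s s0 sN] : exists2 s : R, 0 < s &
    forall n, (n < N)%N -> mdist q (z n) < s -> z n = q.
  elim: N {zN} => [|N [s s0 sN]]; first by exists 1.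
  have [zq|zNq] := eqVneq (z N) q.
    by exists s => // n; rewrite ltnS leq_eqVlt => /predU1P[->|/sN].
  exists (Num.min s (mdist q (z N))).
    by rewrite lt_min s0 mdist_gt0 eq_sym.
  move=> n; rewrite ltnS leq_eqVlt lt_min => /predU1P[->|nN] /andP[ns zn].
    by rewrite ltxx in zn.
  exact: sN.
exists (Num.min r s) => [|n]; first by rewrite lt_min r0.
rewrite lt_min => /andP[nr ns]; have [Nn|nN] := leqP N n; last exact: sN.
by move: nr; rewrite ltNge zN.
Qed.

Lemma no_cluster_closed z : no_cluster z -> closed (range z).
Proof.
move=> zP; rewrite -openC openE => q zq; apply/nbhs_mdistP.
have [r r0 hr] := no_cluster_isolated zP q; exists r => // a qa [n _ zna].
by apply: zq; exists n => //; apply: hr; rewrite zna.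
Qed.

End metric_space.

(** * Oscillating bumps in noncompact balls *)

Section bumps.
Context {R : realType} {X : metricType R}.
Implicit Types (f g h : X -> R) (U K : set X) (q p : X).

(* If every sequence of [K] clusters then [K] is totally bounded, so an
   ultrafilter on [K] contains arbitrarily small balls; a cluster point of a
   sequence picked in finite intersections of these is a limit of the
   ultrafilter. *)
Lemma noncompact_no_cluster K : closed K -> ~ compact K ->
  exists2 z : nat -> X, no_cluster z & forall n, K (z n).
Proof.
move=> clK ncK; apply: contrapT => hK; apply: ncK.
have {}hK (z : nat -> X) : (forall n, K (z n)) -> exists2 q, K q &
    forall r : R, 0 < r -> forall N, exists2 n, (N <= n)%N & mdist q (z n) < r.
  move=> Kz; have : ~ no_cluster z by move=> zP; apply: hK; exists z.
  move=> /existsNP[q hq]; exists q => [|r r0 N].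
    apply: contrapT => nKq; apply: hq.
    have /nbhs_mdistP[r r0 rK] : nbhs q (~` K).
      by apply: open_nbhs_nbhs; split=> //; exact: closed_openC.
    exists r => //; exists 0%N => n _; rewrite leNgt; apply/negP => /rK.
    by apply; exact: Kz.
  apply: contrapT => hN; apply: hq; exists r => //; exists N => n Nn.
  by rewrite leNgt; apply/negP => qz; apply: hN; exists n.
(* Otherwise points at distance at least [r] from all earlier ones can be chosen forever, and such a
   sequence does not cluster. *)
have Ktb (r : R) : 0 < r -> exists s : seq X,
    forall a, K a -> exists2 p, p \in s & mdist p a < r.
  move=> r0; apply: contrapT => /forallNP hs.
  have /choice[next nextP] (s : seq X) :
      exists a, K a /\ forall p, p \in s -> r <= mdist p a.
    have /existsNP[a /not_implyP[Ka ha]] := hs s; exists a; split=> // p ps.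
    by rewrite leNgt; apply/negP => pa; apply: ha; exists p.
  pose s := fix s n := if n is m.+1 then next (s m) :: s m else [::].
  have sm m n : (m < n)%N -> next (s m) \in s n.
    elim: n => // n IH; rewrite ltnS leq_eqVlt => /predU1P[->|/IH mn].
      by rewrite mem_head.
    by rewrite inE mn orbT.
  have [n|q _ qP] := hK (next \o s); first by have [] := nextP (s n).
  have r20 : 0 < r / 2 by rewrite divr_gt0.
  have [m _ qm] := qP _ r20 0%N; have [n mn qn] := qP _ r20 m.+1.
  have := (nextP (s n)).2 _ (sm _ _ mn); apply/negP; rewrite -ltNge.
  rewrite (le_lt_trans (metric_triangle _ q _))// [ltRHS]splitr ltrD//.
  by rewrite metric_sym.
rewrite compact_ultra => F FU FK.
have FF : ProperFilter F := ultra_proper.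
have Fball (n : nat) : exists p, F [set a | mdist p a < n.+1%:R^-1].
  have [|s sK] := Ktb n.+1%:R^-1; first by rewrite invr_gt0.
  have : F [set a | exists2 p, p \in s & mdist p a < n.+1%:R^-1].
    by apply: filterS FK.
  elim: s {sK} => [|p s IH] Fs.
    by have [a []] := filter_ex Fs.
  have [?|Fp] := in_ultra_setVsetC [set a | mdist p a < n.+1%:R^-1] FU.
    by exists p.
  apply: IH; apply: filterS (filterI Fp Fs) => a [/= pa [p']].
  by rewrite inE => /predU1P[->//|p's p'a]; exists p'.
have [c Fc] := choice Fball.
have FW n : F [set a | forall k, (k < n)%N -> mdist (c k) a < k.+1%:R^-1].
  elim: n => [|n IH]; first by apply: filterS filterT.
  apply: filterS (filterI (Fc n) IH) => a [/= an ak] k.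
  by rewrite ltnS leq_eqVlt => /predU1P[->//|]; exact: ak.
have /choice[z zP] n : exists a, K a /\
    forall k, (k < n)%N -> mdist (c k) a < k.+1%:R^-1.
  by have [a [Ka ha]] := filter_ex (filterI FK (FW n)); exists a.
have [n|q Kq qP] := hK z; first by have [] := zP n.
exists q; split=> // V /nbhs_mdistP[r r0 rV].
(* The path from [q] through [z n] and [c m] to [a] has three steps, each shorter than [r / 3]. *)
have [m mr] : exists m, (m.+1%:R^-1 : R) < r / 3.
  have r30 : 0 < r / 3 by rewrite divr_gt0.
  exists (Num.truncn (r / 3)^-1).
  rewrite -[ltRHS]invrK ltf_pV2 ?posrE ?invr_gt0//.
  exact: truncnS_gt.
have [|n mn qn] := qP (r / 3) _ m.+1; first by rewrite divr_gt0.
apply: filterS (Fc m) => a /= ca; apply: rV.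
have zc := (zP n).2 m mn.
have := metric_triangle q (z n) a; have := metric_triangle (z n) (c m) a.
rewrite [mdist (z n) (c m)]metric_sym.
move: (m.+1%:R^-1) mr zc ca qn => e; lra.
Qed.

(** A closed ball contains a sequence [z] without cluster points. A Urysohn function that is 1 on
    [z] and 0 on ever closer companions [z'] oscillates by 1 at every scale. *)
Lemma bump_exists : nowhere_locally_compact X -> forall p (r : R), 0 < r ->
  exists g, [/\ continuous g, forall a, 0 <= g a <= 1,
    forall a, r <= mdist p a -> g a = 0 &
    osc_ge 1 g [set a | mdist p a < r]].
Proof.
move=> nlc p r r0.
pose K := [set a | mdist p a <= r / 2].
have clK : closed K.
  rewrite -openC openE => a /negP; rewrite -ltNge => pa; apply/nbhs_mdistP.
  exists (mdist p a - r / 2) => [|b ab]; first by rewrite subr_gt0.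
  apply/negP; rewrite -ltNge.
  have := metric_triangle p b a; rewrite [mdist b a]metric_sym; lra.
have ncK : ~ compact K.
  move=> cK; apply: (nlc p); exists K => //; apply/nbhs_mdistP.
  by exists (r / 2) => [|a /ltW//]; rewrite divr_gt0.
have [z zP zK] := noncompact_no_cluster clK ncK.
have /choice[z' z'P] n : exists a, [/\ mdist (z n) a < n.+1%:R^-1,
    mdist (z n) a < r / 2 & ~ range z a].
  have [s s0 hs] := no_cluster_isolated zP (z n).
  pose t := Num.min (n.+1%:R^-1) (Num.min (r / 2) s).
  have t0 : 0 < t by rewrite !lt_min s0 invr_gt0 divr_gt0// andbT/= ltr0n.
  have [a [aNz]] : exists a, a <> z n /\ mdist (z n) a < t.
    (* An isolated point would have itself as a compact neighbourhood. *)
    apply: contrapT => h; apply: (nlc (z n)).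
    exists [set z n]; last exact: compact_set1.
    apply/nbhs_mdistP; exists t => // a za; apply: contrapT => aNz.
    by apply: h; exists a.
  rewrite !lt_min => /and3P[an ar as'].
  by exists a; split=> // -[m _ zma]; apply: aNz; rewrite -zma hs// zma.
have z'nc : no_cluster z'.
  move=> q; have [s s0 [N sN]] := zP q.
  exists (s / 2); first by rewrite divr_gt0.
  exists (maxn N (Num.truncn (s / 2)^-1)) => n.
  rewrite geq_max => /andP[Nn tn].
  have n_s : (n.+1%:R^-1 : R) < s / 2.
    rewrite -[ltRHS]invrK ltf_pV2 ?posrE ?invr_gt0 ?divr_gt0//.
    by rewrite (lt_le_trans (truncnS_gt _))// ler_nat.
  have [zz' _ _] := z'P n; have := sN n Nn.
  have := metric_triangle q (z' n) (z n); rewrite [mdist (z' n) _]metric_sym.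
  move: (n.+1%:R^-1) zz' n_s => e; lra.
(* Separate [z] from [z'], whose terms get arbitrarily close to those of [z]. *)
pose B := range z' `|` [set a | r <= mdist p a].
have clB : closed B.
  apply: closedU; first exact: no_cluster_closed.
  rewrite -openC openE => a /negP; rewrite -ltNge => pa; apply/nbhs_mdistP.
  exists (r - mdist p a) => [|b ab]; first by rewrite subr_gt0.
  by apply/negP; rewrite -ltNge; have := metric_triangle p a b; lra.
have BA0 : B `&` range z = set0.
  rewrite -subset0 => a [Ba [n _ zna]]; case: Ba => [[m _ ma]|/=].
    by have [_ _] := z'P m; apply; exists n => //; rewrite ma.
  by rewrite -zna; have := zK n; rewrite /K/=; lra.
have sep := (@normal_separatorP R X).1 pseudometric_normal _ _ clB
  (no_cluster_closed zP) BA0.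
exists (Urysohn B (range z)); split.
- exact: (@Urysohn_continuous X R).
- move=> a; have : range (Urysohn B (range z) : X -> R) (Urysohn B (range z) a).
    by exists a.
  by move=> /Urysohn_range; rewrite /= in_itv.
- by move=> a ra; apply: (Urysohn_sub0 sep); exists a => //; right.
- move=> s s0.
  pose n := Num.truncn s^-1; have [z1 z2 _] := z'P n.
  exists (z n), (z' n); split.
  + by rewrite /= (le_lt_trans (zK n))// gtr_pMr// invf_lt1// ltr1n.
  + rewrite /=; have := metric_triangle p (z n) (z' n); have := zK n.
    by rewrite /K/=; lra.
  + rewrite (lt_trans z1)// -[ltRHS]invrK ltf_pV2 ?posrE ?invr_gt0//.
    exact: truncnS_gt.
  + rewrite [X in `|X - _|](Urysohn_sub1 sep); last first.
      by exists (z n) => //; exists n.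
    rewrite [X in `|_ - X|](Urysohn_sub0 sep); last first.
      by exists (z' n) => //; left; exists n.
    by rewrite subr0 normr1.
Qed.

End bumps.

(** * A nowhere locally uniformly continuous function *)

Section gluing.
Context {R : realType} {X : metricType R}.
Implicit Types (f g h : X -> R) (q p : X).

Section bump_glue.
Context {I : Type}.
Variables (c : I -> X) (s : R) (G : I -> X -> R).

(** Under [c_sep] the balls of radius [s / 4] are disjoint, so the chosen index is the only one
    possible. *)
Definition bump_glue q : R :=
  if pselect (exists i, mdist (c i) q < s / 4) is left e
  then G (sval (cid e)) q else 0.

Hypothesis c_sep : forall i j, mdist (c i) (c j) < s -> i = j.

Lemma bump_glueE i q : mdist (c i) q < s / 4 -> bump_glue q = G i q.
Proof.
move=> iq; rewrite /bump_glue; case: pselect => [e|[]]; last by exists i.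
case: cid => j /= jq; congr (G _ _); apply: c_sep.
have := metric_triangle (c j) q (c i); have := mdist_ge0 (c i) q.
rewrite [mdist q _]metric_sym; lra.
Qed.

Hypothesis G_supp : forall i q, s / 4 <= mdist (c i) q -> G i q = 0.

(** Two centres whose balls both meet the ball around [q] are joined by four steps shorter than
    [s / 4], hence coincide. *)
Lemma bump_glue_local q :
  (exists i, forall a, mdist q a < s / 4 -> bump_glue a = G i a) \/
  (forall a, mdist q a < s / 4 -> bump_glue a = 0).
Proof.
have [[i [a0 qa0 ia0]]|ni] :=
  pselect (exists i, exists2 a, mdist q a < s / 4 & mdist (c i) a < s / 4).
  left; exists i => a qa; have [ia|ia] := ltP (mdist (c i) a) (s / 4).
    exact: bump_glueE.
  rewrite G_supp// /bump_glue; case: pselect => // e; case: cid => j /= ja.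
  have ij : i = j.
    apply: c_sep; have := metric_triangle (c i) a0 (c j).
    have := metric_triangle a0 q (c j); have := metric_triangle q a (c j).
    rewrite [mdist a0 q]metric_sym [mdist a _]metric_sym; lra.
  by move: ja; rewrite -ij ltNge ia.
right=> a qa; rewrite /bump_glue; case: pselect => // -[i ia].
by exfalso; apply: ni; exists i, a.
Qed.

Lemma bump_glue_continuous : 0 < s -> (forall i, continuous (G i)) ->
  continuous bump_glue.
Proof.
move=> s0 cG; apply/continuous_mdistP => q eps eps0.
have s40 : 0 < s / 4 by rewrite divr_gt0.
have qq : mdist q q < s / 4 by rewrite mdistxx.
have [[i iG]|G0] := bump_glue_local q.
  have [r r0 rG] := (continuous_mdistP _).1 (cG i) q eps eps0.
  exists (Num.min r (s / 4)) => [|a]; first by rewrite lt_min r0.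
  by rewrite lt_min => /andP[ar as4]; rewrite !iG//; exact: rG.
by exists (s / 4) => // a qa; rewrite !G0// subrr normr0.
Qed.

End bump_glue.

Definition dist_separated (s : R) (D : set X) : Prop :=
  forall p q, D p -> D q -> mdist p q < s -> p = q.

Lemma maximal_separated (s : R) : 0 < s -> exists2 D, dist_separated s D &
  forall q, exists2 p, D p & mdist p q < s.
Proof.
move=> s0; have [F FP Ftot|D [sD maxD]] := @Zorn_bigcup X (dist_separated s).
  move=> p q [A FA Ap] [B FB Bq].
  have [AB|BA] := Ftot _ _ FA FB.
    by apply: (FP B) => //; exact: AB.
  by apply: (FP A) => //; exact: BA.
exists D => // q; apply: contrapT => hq; apply: (maxD (D `|` [set q])).
  split=> [|Dq]; first by left.
  by apply: hq; exists q; [apply: Dq; right|rewrite mdistxx].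
move=> a b [Da|->] [Db|->] ab //; first exact: sD.
  by exfalso; apply: hq; exists a.
by exfalso; apply: hq; exists b => //; rewrite metric_sym.
Qed.

Hypothesis nlc : nowhere_locally_compact X.

Lemma oscillating_perturbation (s c : R) f : 0 < s -> 0 < c -> continuous f ->
  exists f', [/\ continuous f', forall a, f a <= f' a <= f a + c &
    forall q, exists2 p, mdist p q < s &
      osc_ge (c / 2) f' [set a | mdist p a < s / 4]].
Proof.
move=> s0 c0 cf; have [D sD netD] := maximal_separated s0.
have s40 : 0 < s / 4 by rewrite divr_gt0.
(* Either [f] already oscillates by [c / 2] in the ball, or adding [c] times a
   bump makes it do so. *)
have /choice[G GP] (p : D) : exists g, [/\ continuous g,
    forall a, 0 <= g a <= c,
    forall a, s / 4 <= mdist (val p) a -> g a = 0 &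
    osc_ge (c / 2) (fun a => f a + g a) [set a | mdist (val p) a < s / 4]].
  have [g [cg g01 g0 og]] := bump_exists nlc (val p) s40.
  have ocg : osc_ge c (fun a => c * g a) [set a | mdist (val p) a < s / 4].
    move=> r r0; have [a [b [pa pb ab gab]]] := og r r0.
    by exists a, b; split=> //; rewrite -mulrBr normrM gtr0_norm// ler_pMr.
  have [of_|of_] := osc_geD f ocg.
    exists (fun=> 0); split=> //.
    - by move=> a; exact: cvg_cst.
    - by move=> a; rewrite lexx ltW.
    - by under eq_fun do rewrite addr0.
  exists (fun a => c * g a); split=> //.
  - by move=> a; apply: cvgM; [exact: cvg_cst|exact: cg].
  - move=> a; have /andP[g0a ga1] := g01 a.
    by rewrite mulr_ge0 ?(ltW c0)//= ger_pMr.
  - by move=> a /g0 ->; rewrite mulr0.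
have sepD (p q : D) : mdist (val p) (val q) < s -> p = q.
  by move=> pq; apply/val_inj/sD => //; exact: set_valP.
pose u := bump_glue (fun p : D => val p) s G.
have Gsupp (p : D) a : s / 4 <= mdist (val p) a -> G p a = 0.
  by have [_ _ + _] := GP p; apply.
exists (fun a => f a + u a); split.
- move=> a; apply: cvgD; first exact: cf.
  by apply: bump_glue_continuous => // p; have [] := GP p.
- move=> a; rewrite lerDl lerD2l.
  have aa : mdist a a < s / 4 by rewrite mdistxx.
  have [[p pG]|G0] := bump_glue_local sepD Gsupp a; rewrite /u.
    by rewrite pG//; have [_ + _ _] := GP p; apply.
  by rewrite G0// lexx ltW.
- move=> q; have [p Dp pq] := netD q; exists p => //.
  have [_ _ _ op] := GP (SigSub (mem_set Dp)).
  move=> r r0; have [a [b [/= pa pb ab fab]]] := op r r0.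
  exists a, b; split=> //.
  by rewrite /u !(bump_glueE G sepD (i := SigSub (mem_set Dp))).
Qed.

Lemma nowhere_locally_unif_continuous_exists : exists h : X -> R,
  [/\ continuous h, forall a, `|h a| <= 2 & nowhere_locally_unif_continuous h].
Proof.
pose c n : R := 8^-1 ^+ n.
have c0 n : 0 < c n by rewrite exprn_gt0.
have cS n : c n.+1 = c n / 8 by rewrite /c exprS mulrC.
have /choice[P PP] (nf : nat * {f : X -> R | continuous f}) :
    exists f' : {f : X -> R | continuous f},
      (forall a, sval nf.2 a <= sval f' a <= sval nf.2 a + c nf.1) /\
      forall q, exists2 p, mdist p q < nf.1.+1%:R^-1 &
        osc_ge (c nf.1 / 2) (sval f') [set a | mdist p a < nf.1.+1%:R^-1 / 4].
  have s0 : 0 < (nf.1.+1%:R^-1 : R) by rewrite invr_gt0.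
  have [f' [cf' f'1 f'2]] :=
    oscillating_perturbation s0 (c0 nf.1) (svalP nf.2).
  by exists (exist _ _ cf').
have cont0 : continuous (fun _ : X => 0 : R) by move=> a; exact: cvg_cst.
pose S := fix S n := if n is m.+1 then P (m, S m) else exist _ _ cont0.
pose F n : X -> R := sval (S n).
have FS n a : F n a <= F n.+1 a <= F n a + c n.
  by have [+ _] := PP (n, S n); apply.
have F_nd m n a : (m <= n)%N -> F m a <= F n a.
  move=> mn; rewrite -(subnK mn); elim: (n - m)%N => // k IH.
  by rewrite addSn (le_trans IH)//; have /andP[] := FS (k + m)%N a.
(* [8 / 7 * c n] is the geometric tail of the increments from [n] on, so these upper bounds
   decrease. *)
have E_ni m n a : (m <= n)%N -> F n a + 8 / 7 * c n <= F m a + 8 / 7 * c m.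
  move=> mn; rewrite -(subnK mn); elim: (n - m)%N => // k IH.
  rewrite addSn (le_trans _ IH)// cS.
  by have /andP[_] := FS (k + m)%N a; lra.
have F_ub m n a : F m a <= F n a + 8 / 7 * c n.
  have cn := c0 n; have cm := c0 m; have [mn|/ltnW nm] := leqP m n.
    by rewrite (le_trans (F_nd _ _ _ mn))// lerDl; lra.
  by have := E_ni _ _ a nm; lra.
pose h a := sup (range (F^~ a)).
have F_h n a : F n a <= h a.
  by apply: ub_le_sup; [exists (F n a + 8 / 7 * c n) => _ [m _ <-]|exists n].
have h_F n a : h a <= F n a + 8 / 7 * c n.
  by apply: ge_sup => [|_ [m _ <-]//]; exists (F 0%N a), 0%N.
exists h; split.
- apply/continuous_mdistP => q eps eps0.
  have [n cn] : exists n, 8 / 7 * c n < eps / 2.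
    pose n := Num.truncn (7 / 16 * eps)^-1; exists n.
    suff : c n < 7 / 16 * eps by lra.
    have e0 : 0 < 7 / 16 * eps by rewrite mulr_gt0.
    rewrite /c exprVn -[ltRHS]invrK ltf_pV2 ?posrE ?exprn_gt0 ?invr_gt0//.
    by rewrite (lt_le_trans (truncnS_gt _))// -natrX ler_nat ltn_expl.
  have eps2 : 0 < eps / 2 by rewrite divr_gt0.
  have [r r0 rF] := (continuous_mdistP _).1 (svalP (S n)) q _ eps2.
  exists r => // a /rF; rewrite -/(F n).
  have := F_h n a; have := F_h n q; have := h_F n a; have := h_F n q.
  move=> h1 h2 h3 h4; rewrite !ltr_norml => /andP[h5 h6].
  apply/andP; split; lra.
- move=> a; have := F_h 0%N a; have := h_F 0%N a.
  by rewrite /F /c /= expr0 => h1 h2; rewrite ler_norml; apply/andP; split; lra.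
- apply/nowhere_locally_unif_continuousP => q r r0.
  pose n := Num.truncn (2 / r).
  have n_r : 2 * n.+1%:R^-1 < r.
    rewrite -ltr_pdivlMl// -[ltRHS]invrK ltf_pV2 ?posrE ?invr_gt0 ?mulr_gt0//.
    by rewrite invfM invrK truncnS_gt.
  have [_ /(_ q)[p pq op]] := PP (n, S n).
  (* [F n.+1] oscillates by [c n / 2], and the tail beyond it is at most [8 / 7 * c n.+1 = c n / 7];
     the difference exceeds [c n / 3]. *)
  exists (c n / 3); first by rewrite divr_gt0.
  have cn := c0 n; move=> s s0; have [a [b [/= pa pb ab Fab]]] := op s s0.
  exists a, b; split=> //.
  - have := metric_triangle q p a; rewrite [mdist q p]metric_sym/=.
    by have := mdist_ge0 p a; move: (n.+1%:R^-1) pa pq n_r => e; lra.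
  - have := metric_triangle q p b; rewrite [mdist q p]metric_sym/=.
    by have := mdist_ge0 p b; move: (n.+1%:R^-1) pb pq n_r => e; lra.
  - have {}Fab : c n / 2 <= `|F n.+1 a - F n.+1 b| by [].
    have := F_h n.+1 a; have := F_h n.+1 b; have := h_F n.+1 a.
    have := h_F n.+1 b; rewrite cS.
    move: Fab; rewrite !ler_normr => /orP[] h5 h1 h2 h3 h4; apply/orP;
      [left|right]; lra.
Qed.

End gluing.

(** * The reduction from the Cantor space *)

Section first_difference.
Context {R : realType}.
Implicit Types x w : nat -> bool.

(* [1 / (n + 1)] for [n] the first index where [x] and [w] differ. *)
Definition cantor_dist x w : R :=
  if pselect (exists n, x n != w n) is left e then (ex_minn e).+1%:R^-1 else 0.

Lemma cantor_distP x w : (x = w /\ cantor_dist x w = 0) \/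
  exists n, [/\ agree n x w, x n != w n & cantor_dist x w = n.+1%:R^-1].
Proof.
rewrite /cantor_dist; case: pselect => [e|h]; [right|left].
  case: ex_minnP => n xwn nmin; exists n; split=> // k kn.
  by apply/eqP; apply: contraTT kn => /nmin; rewrite -leqNgt.
split=> //; apply/funext => n; apply/eqP; apply: contrapT => /negP xwn.
by apply: h; exists n.
Qed.

Lemma cantor_dist_ge0 x w : 0 <= cantor_dist x w.
Proof. by have [[_ ->]|[n [_ _ ->]]] := cantor_distP x w. Qed.

Lemma cantor_dist_le1 x w : cantor_dist x w <= 1.
Proof.
have [[_ ->]|[n [_ _ ->]]] := cantor_distP x w; first exact: ler01.
by rewrite invf_le1// ler1n.
Qed.

Lemma cantor_distxx x : cantor_dist x x = 0.
Proof. by have [[_ ->]|[n [_ /eqP]]] := cantor_distP x x. Qed.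

Lemma cantor_dist_gt0 x w : x <> w -> 0 < cantor_dist x w.
Proof. by have [[-> _]|[n [_ _ -> _]]] := cantor_distP x w. Qed.

(** If one of [x], [x'] leaves [w] before [m], both do so at the same index; otherwise both
    distances lie between 0 and [1 / (m + 1)]. *)
Lemma cantor_dist_agree m x x' w : agree m x x' ->
  `|cantor_dist x w - cantor_dist x' w| <= m.+1%:R^-1.
Proof.
have le_inv n : (m <= n)%N -> (n.+1%:R^-1 : R) <= m.+1%:R^-1.
  by move=> mn; rewrite lef_pV2 ?posrE// ler_nat.
move=> xx'; have [[xw ->]|[n [xw xwn ->]]] := cantor_distP x w;
  have [[xw' ->]|[n' [xw' xwn' ->]]] := cantor_distP x' w.
- by rewrite subrr normr0.
- rewrite sub0r normrN gtr0_norm//; apply: le_inv.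
  by rewrite leqNgt; apply: contraNN xwn' => /xx' <-; rewrite xw.
- rewrite subr0 gtr0_norm//; apply: le_inv.
  by rewrite leqNgt; apply: contraNN xwn => /xx' ->; rewrite xw'.
have [->|nn'] := eqVneq n n'; first by rewrite subrr normr0.
have nm : (m <= n)%N.
  rewrite leqNgt; apply: contraNN nn' => nm; rewrite eqn_leq.
  apply/andP; split; rewrite leqNgt.
    by apply: contraNN xwn' => n'n; rewrite -xx' ?xw//; exact: ltn_trans nm.
  by apply: contraNN xwn => n'n; rewrite xx'// xw'.
have n'm : (m <= n')%N.
  rewrite leqNgt; apply: contraNN nn' => n'm; rewrite eqn_leq.
  apply/andP; split; rewrite leqNgt.
    by apply: contraNN xwn' => n'n; rewrite -xx' ?xw.
  by apply: contraNN xwn => n'n; rewrite xx' ?xw'//; exact: ltn_trans n'm.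
have := le_inv _ nm; have := le_inv _ n'm.
have : 0 < (n.+1%:R^-1 : R) by []. have : 0 < (n'.+1%:R^-1 : R) by [].
move: (n.+1%:R^-1) (n'.+1%:R^-1) (m.+1%:R^-1) => u v t u0 v0 vt ut.
by rewrite ler_norml; apply/andP; split; lra.
Qed.

End first_difference.

Section plateau.
Context {R : realType} {X : metricType R}.
Variables (s : R) (s0 : 0 < s).
Implicit Types p q a b : X.

(** A Lipschitz cutoff: 1 within [s / 8] of [p], 0 from [s / 4] on, linear in the distance
    between. *)
Definition plateau p q : R := Num.max 0 (Num.min 1 (2 - 8 / s * mdist p q)).

Lemma plateau_ge0 p q : 0 <= plateau p q.
Proof. by rewrite le_max lexx. Qed.

Lemma plateau_le1 p q : plateau p q <= 1.
Proof. by rewrite ge_max ler01 ge_min lexx. Qed.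

Lemma plateau_near p q : mdist p q < s / 8 -> plateau p q = 1.
Proof.
move=> pq; have h : 8 / s * mdist p q <= 1.
  by rewrite mulrAC ler_pdivrMr// mul1r; lra.
rewrite /plateau min_l; last by lra.
by rewrite max_r.
Qed.

Lemma plateau_far p q : s / 4 <= mdist p q -> plateau p q = 0.
Proof.
move=> pq; have h : 2 <= 8 / s * mdist p q.
  by rewrite mulrAC ler_pdivlMr//; lra.
by rewrite /plateau max_l// ge_min; apply/orP; right; lra.
Qed.

Lemma plateau_lipschitz p a b :
  `|plateau p a - plateau p b| <= 8 / s * mdist a b.
Proof.
have L0 : 0 <= 8 / s by rewrite divr_ge0 ?ltW.
have h1 : 8 / s * mdist p a <= 8 / s * mdist p b + 8 / s * mdist a b.
  by rewrite -mulrDr ler_wpM2l// [mdist a b]metric_sym metric_triangle.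
have h2 : 8 / s * mdist p b <= 8 / s * mdist p a + 8 / s * mdist a b.
  by rewrite -mulrDr ler_wpM2l// metric_triangle.
have h3 : 0 <= 8 / s * mdist a b by rewrite mulr_ge0 ?mdist_ge0.
rewrite /plateau.
move: (8 / s * mdist p a) (8 / s * mdist p b) (8 / s * mdist a b) h1 h2 h3.
move=> u v t h1 h2 h3; rewrite ler_norml; apply/andP; split;
  rewrite /Order.max /Order.min; do !case: ifPn; rewrite -?leNgt; lra.
Qed.

End plateau.

(** If all separated sets were countable, the union of maximal [1 / (n + 1)]-separated ones would be
    countable and dense. *)
Lemma nonseparable_uncountable_separated (R : realType) (X : metricType R) :
  ~ separable X ->
  exists s : R, exists2 D : set X, 0 < s /\ dist_separated s D & ~ countable D.
Proof.
move=> nsX; apply: contrapT => h; apply: nsX.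
have inv0 n : 0 < (n.+1%:R^-1 : R) by [].
have /choice[D DP] n : exists D : set X, dist_separated n.+1%:R^-1 D /\
    forall q, exists2 p, D p & mdist p q < n.+1%:R^-1.
  by have [D sD netD] := @maximal_separated R X _ (inv0 n); exists D.
exists (\bigcup_n D n).
  apply: bigcup_countable => // n _; apply: contrapT => ncD; apply: h.
  by exists n.+1%:R^-1, (D n) => //; split=> //; have [] := DP n.
move=> O [q Oq] oO; have /nbhs_mdistP[r r0 rO] := open_nbhs_nbhs (conj oO Oq).
pose n := Num.truncn r^-1.
have [_ /(_ q)[p Dp pq]] := DP n; exists p; split; last by exists n.
apply: rO; rewrite metric_sym (lt_trans pq)// -[ltRHS]invrK.
by rewrite ltf_pV2 ?posrE ?invr_gt0// truncnS_gt.
Qed.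

(** The index at [q] is the same for all [G], so functions glued for different points of the Cantor
    space can be compared. *)
Lemma bump_glue_uniform {R : realType} {X : metricType R} {I : Type}
    (c : I -> X) (s : R) (q : X) :
  (forall i j, mdist (c i) (c j) < s -> i = j) ->
  (exists i, forall G, bump_glue c s G q = G i q) \/
  (forall G, bump_glue c s G q = 0).
Proof.
move=> c_sep; have [[i iq]|ni] := pselect (exists i, mdist (c i) q < s / 4).
  by left; exists i => G; exact: bump_glueE.
by right=> G; rewrite /bump_glue; case: pselect.
Qed.

Section reduction.
Context {R : realType} {X : metricType R} {I : Type}.
Variables (h : X -> R) (c : I -> X) (w : I -> nat -> bool) (s : R).
Hypotheses (s0 : 0 < s) (ch : continuous h) (h2 : forall a, `|h a| <= 2).
Hypothesis nh : nowhere_locally_unif_continuous h.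
Hypothesis c_sep : forall i j, mdist (c i) (c j) < s -> i = j.
Implicit Types (x : nat -> bool) (q a b : X).

(** Chosen so that [rho x] equals [cantor_dist x (w i)] within [s / 8] of [c i], and 1 off the balls
    of radius [s / 4]. *)
Let G x i q : R := (1 - cantor_dist x (w i)) * plateau s (c i) q.
Let rho x q : R := 1 - bump_glue c s (G x) q.
Let Phi_fun x q : R := h q * rho x q.

Let coef01 x i : 0 <= (1 - cantor_dist x (w i) : R) <= 1.
Proof. by rewrite subr_ge0 cantor_dist_le1 lerBlDr lerDl cantor_dist_ge0. Qed.

Let G_supp x i q : s / 4 <= mdist (c i) q -> G x i q = 0.
Proof. by move=> iq; rewrite /G plateau_far// mulr0. Qed.

Let G_lipschitz x i a b : `|G x i a - G x i b| <= 8 / s * mdist a b.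
Proof.
have /andP[t0 t1] := coef01 x i; rewrite -mulrBr normrM ger0_norm//.
by rewrite (le_trans _ (plateau_lipschitz s0 (c i) a b))// ler_piMl.
Qed.

Let G01 x i q : 0 <= G x i q <= 1 - cantor_dist x (w i).
Proof.
have /andP[t0 t1] := coef01 x i.
by rewrite mulr_ge0 ?plateau_ge0//= ler_piMr ?plateau_le1.
Qed.

Let rho_continuous x : continuous (rho x).
Proof.
move=> q; apply: cvgB; first exact: cvg_cst.
apply: bump_glue_continuous => [//|i q' iq'|//|i]; first exact: G_supp.
apply/continuous_mdistP => a eps eps0.
exists (eps / (8 / s)) => [|b ab]; first by rewrite !divr_gt0.
by rewrite (le_lt_trans (G_lipschitz x i a b))// -ltr_pdivlMl ?divr_gt0// mulrC.
Qed.

Let rho01 x q : 0 <= rho x q <= 1.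
Proof.
rewrite /rho; have [[i ->]|->] := bump_glue_uniform q c_sep; last first.
  by rewrite subr0 ler01 lexx.
have /andP[g0 g1] := G01 x i q; have /andP[t0 t1] := coef01 x i.
by apply/andP; split; lra.
Qed.

Let Phi_bcont x : Phi_fun x \in @bcont R X.
Proof.
apply: mem_set; split.
  by move=> q; apply: cvgM; [exact: ch|exact: rho_continuous].
apply/bounded_fun_leP; exists 2 => q; rewrite normrM.
have /andP[r0 r1] := rho01 x q; rewrite (ger0_norm r0).
by rewrite (le_trans _ (h2 q))// ler_piMr.
Qed.

Definition reduction x : Cb X := MkCb (Phi_bcont x).

Lemma reduction_agree m x x' : agree m x x' ->
  `|reduction x - reduction x'| <= 2 / m.+1%:R.
Proof.
move=> xx'; apply: sup_norm_le => [|q]; first by rewrite divr_ge0.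
have -> : (reduction x - reduction x') q = Phi_fun x q - Phi_fun x' q by [].
have -> : Phi_fun x q - Phi_fun x' q =
    h q * (bump_glue c s (G x') q - bump_glue c s (G x) q).
  by rewrite /Phi_fun /rho; ring.
rewrite normrM ler_pM//.
have [[i iG]|G0] := bump_glue_uniform q c_sep; last by rewrite !G0 subrr normr0.
rewrite !iG /G -mulrBl normrM.
have -> : 1 - cantor_dist x' (w i) - (1 - cantor_dist x (w i)) =
    cantor_dist x (w i) - cantor_dist x' (w i) :> R by ring.
rewrite (le_trans _ (cantor_dist_agree (w i) xx'))//.
by rewrite ler_piMr// ger0_norm ?plateau_ge0 ?plateau_le1.
Qed.

(** If [x = w i], the function vanishes near [c i]. Otherwise, even if the [w i] accumulate at [x],
    only one of them matters near [q]: there [rho x] is Lipschitz and bounded below by some [t > 0],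
    so multiplying by it preserves oscillation. *)
Lemma reduction_nowhere_locally_unif_continuous x :
  nowhere_locally_unif_continuous (reduction x : X -> R) <-> ~ range w x.
Proof.
split=> [nx [i _ wx]|nwx].
  apply: (nx (c i)); exists [set a | mdist (c i) a < s / 8].
    by apply/nbhs_mdistP; exists (s / 8) => //; rewrite divr_gt0.
  have x0 a : mdist (c i) a < s / 8 -> reduction x a = 0.
    move=> ia; rewrite /= /Phi_fun /rho.
    rewrite (bump_glueE _ c_sep (i := i)); last first.
      by have := s0; lra.
    by rewrite /G -wx cantor_distxx subr0 mul1r plateau_near// subrr mulr0.
  apply/unif_continuous_onP => eps eps0; exists 1 => // a b ia ib _.
  by rewrite !x0// subrr normr0.
apply/nowhere_locally_unif_continuousP => q r r0.
have [t t0 [rho_ge rho_lip]] : exists2 t : R, 0 < t &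
    (forall a, mdist q a < s / 4 -> t <= rho x a) /\
    forall a b, mdist q a < s / 4 -> mdist q b < s / 4 ->
      `|rho x a - rho x b| <= 8 / s * mdist a b.
  have [[i iG]|G0] := bump_glue_local c_sep (@G_supp x) q.
    exists (cantor_dist x (w i)).
      by apply: cantor_dist_gt0 => xw; apply: nwx; exists i.
    split=> [a /iG|a b /iG qa /iG qb].
      by rewrite /rho => ->; have /andP[_] := G01 x i a; lra.
    rewrite /rho qa qb distrC.
    have -> : 1 - G x i b - (1 - G x i a) = G x i a - G x i b by ring.
    exact: G_lipschitz.
  exists 1 => //; split=> [a /G0|a b /G0 qa /G0 qb].
    by rewrite /rho => ->; rewrite subr0.
  by rewrite /rho qa qb subrr normr0 mulr_ge0 ?mdist_ge0// divr_ge0// ltW.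
have /nowhere_locally_unif_continuousP/(_ q (Num.min r (s / 4)))[|k k0 hk] := nh.
  by rewrite lt_min r0 divr_gt0.
have kt0 : 0 < k * t by rewrite mulr_gt0.
exists (k * t / 2); first by rewrite divr_gt0.
(* At this scale [rho x] varies by at most [k * t / 4]; as [|h| <= 2], this costs at most half of
   the [k * t] gained from [h]. *)
move=> d d0; have [|a [b [/=]]] := hk (Num.min d (k * t / 4 / (8 / s))).
  by rewrite lt_min d0 !divr_gt0.
rewrite !lt_min => /andP[ar as4] /andP[br bs4] /andP[abd abk] hab.
exists a, b; split=> //.
have {abk} lab : 8 / s * mdist a b <= k * t / 4.
  by rewrite mulrC -ler_pdivlMr ?divr_gt0// ltW.
have lip := le_trans (rho_lip _ _ as4 bs4) lab.
have main : k * t <= `|h a - h b| * rho x a.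
  by apply: ler_pM => //; [exact: ltW|exact: ltW|exact: rho_ge].
have rest : `|h b * (rho x a - rho x b)| <= k * t / 2.
  rewrite normrM (le_trans (ler_pM _ _ (h2 b) lip))//; lra.
have -> : reduction x a - reduction x b =
    (h a - h b) * rho x a + h b * (rho x a - rho x b).
  by rewrite /= /Phi_fun; move: (rho x) => f; ring.
have rho0 : 0 <= rho x a by have /andP[] := rho01 x a.
have := ler_normB ((h a - h b) * rho x a + h b * (rho x a - rho x b))
  (h b * (rho x a - rho x b)).
rewrite addrK normrM (ger0_norm rho0); lra.
Qed.

End reduction.

Theorem theorem1 (R : realType) (X : metricType R)
    (nonsepX : ~ separable X) (nlcX : nowhere_locally_compact X) :
  ~ borel [set f : Cb X | nowhere_locally_unif_continuous (f : X -> R)].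
Proof.
have [s [D [s0 sD] ncD]] := nonseparable_uncountable_separated nonsepX.
have [T [lt [c [oT cI cD]]]] := uncountable_omega1_like ncD.
have c_sep i j : mdist (c i) (c j) < s -> i = j.
  by move=> ij; apply/cI/sD => //; apply: cD; [exists i|exists j].
(* Injections of the countable initial segments into [nat], needed to write the codes. *)
have /choice[e eP] i : exists e : T -> nat,
    forall a b, lt a i -> lt b i -> e a = e b -> a = b.
  have /countable_injP[e einj] := o1_countable oT i.
  by exists e => a b ai bi; apply: einj; exact: mem_set.
have [h [ch h2 nh]] := nowhere_locally_unif_continuous_exists nlcX.
pose w := order_code lt e; pose Phi := reduction w s0 ch h2 c_sep.
move=> /(@borel_preimage_bianalytic _ Phi)[U oU x Ux|_].
  have /nbhs_ballP[eps eps0 epsU] := open_nbhs_nbhs (conj oU Ux).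
  exists (Num.truncn (2 / eps)) => x' xx'; apply: epsU.
  rewrite -ball_normE/=; apply: le_lt_trans (reduction_agree _ _ _ _ _ xx') _.
  by rewrite ltr_pdivrMr// mulrC -ltr_pdivrMr// truncnS_gt.
(* The preimage is the complement of [range w], so its own complement is [range w]. *)
rewrite [X in analytic X](_ : _ = range w).
  exact: (order_codes_nonanalytic oT eP).
rewrite -[RHS]setCK; congr (~` _); apply/funext => x; apply/propext.
exact: reduction_nowhere_locally_unif_continuous.
Qed.
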